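(* Let $n \ge 1$ and let $k$ and $\ell$ be positive integers. Among all pairs $(T,v)$ with $T \in \mathcal{T}_n$ and $v$ a vertex of $T$, there are one-to-one correspondences between the following four sets: (i) pairs $(T,v)$ with $v$ a first-child of degree $k$ at level $\ell$ in $T$; (ii) pairs $(T,v)$ with $v$ a non-first-child of degree $k$ at level $\ell-1$ in $T$; (iii) pairs $(T,v)$ with $v$ a leaf of $T$ having exactly $k-1$ elder siblings, at level $\ell$; (iv) pairs $(T,v)$ with $v$ a non-leaf of outdegree $k$ at level $\ell-1$ in $T$. Moreover, the cardinality of each of these sets is $$\frac{k+2\ell-2}{2n-k}\binom{2n-k}{n+\ell-1}.$$
   Context: $\mathcal{T}_n$ denotes the set of rooted ordered (plane) trees with $n$ edges. In such a tree, $v$ is a child of $u$ (and $u$ the parent of $v$) if $v$ is adjacent to $u$ and farther from the root; the root is not a child of any vertex. Vertices with the same parent are siblings; siblings are linearly ordered left to right, and the siblings to the left of $v$ are its elder siblings. The first-child is the leftmost among a set of siblings; a non-first-child is any vertex that is not a first-child (in particular the root is a non-first-child). A leaf is a vertex with no children. The degree of a vertex is the number of edges incident to it; its outdegree is its number of children. The level of a vertex is its distance (number of edges) from the root. *)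

(* Defs.v *)
From mathcomp Require Import all_boot all_order all_algebra.
From mathcomp Require Import classical_sets cardinality.

Set Implicit Arguments.
Unset Strict Implicit.
Unset Printing Implicit Defensive.

(* A rooted ordered tree is given by the left-to-right sequence of the subtrees
   hanging from its root. *)
Inductive plane_tree := Node of seq plane_tree.

Fixpoint edges (t : plane_tree) : nat :=
  let: Node ts := t in sumn [seq (edges s).+1 | s <- ts].

(* A vertex is named by its address: the sequence of 0-based child positions
   along the path from the root, outermost first. *)
Definition address := seq nat.

(* Lists every vertex exactly once (uniq_vertices). *)
Fixpoint vertices (t : plane_tree) : seq address :=
  let: Node ts := t in
  [::] :: [seq i :: w | i <- iota 0 (size ts),
                        w <- nth [::] [seq vertices s | s <- ts] i].

(* The path from the root to v has one edge per entry of the address v. *)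
Definition level (v : address) : nat := size v.

(* The root has no parent; parent [::] = [::] is a junk value, guarded below. *)
Definition parent (v : address) : address := take (size v).-1 v.

Definition child (u v : address) : bool := (v != [::]) && (parent v == u).

Definition adjacent (u v : address) : bool := child u v || child v u.

Definition siblings (u v : address) : bool :=
  [&& u != [::], v != [::] & parent u == parent v].

(* elder_sibling v u: u is a sibling of v lying to the left of v. *)
Definition elder_sibling (v u : address) : bool :=
  siblings u v && (last 0 u < last 0 v).

Definition first_child (t : plane_tree) (v : address) : bool :=
  (v != [::]) && ~~ has (elder_sibling v) (vertices t).

Definition leaf (t : plane_tree) (v : address) : bool :=
  ~~ has (child v) (vertices t).

Definition degree (t : plane_tree) (v : address) : nat :=
  count (adjacent v) (vertices t).

Definition outdegree (t : plane_tree) (v : address) : nat :=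
  count (child v) (vertices t).

Definition elder_siblings (t : plane_tree) (v : address) : nat :=
  count (elder_sibling v) (vertices t).

Definition marked_trees (n : nat) (P : plane_tree -> address -> bool) :
    set (plane_tree * address) :=
  [set p | [/\ edges p.1 = n, p.2 \in vertices p.1 & P p.1 p.2]]%classic.

Lemma uniq_vertices (t : plane_tree) : uniq (vertices t).
Proof.
move: t; fix IH 1 => -[ts] /=; apply/andP; split.
  by apply/negP => /allpairsPdep[i [w [_ _]]].
apply: allpairs_uniq_dep => [|i _|[i w] [j x] _ _ /= [-> ->] //].
  exact: iota_uniq.
elim: ts i => [|t ts IHts] [|i] //=; exact: IH.
Qed.

(* Main.v *)
(* All four sets are in bijection with the ordered forests of k + 2l - 2 trees
   and n - l - k + 1 edges. Cutting a marked tree along the path from the root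
   to v, each proper ancestor of v splits into two trees, carrying its children
   to the left and to the right of the path; together with the subtrees hanging
   from v this gives the forest for (iv). In (i)-(iii) the cut at the parent of v
   is refined: a tree known to be a single vertex is dropped, one known to have
   an edge is split at its leftmost edge, and a tree whose root has k - 1
   children is replaced by the subtrees hanging from it. Such forests are counted by a ballot recursion: a
   first tree that is a single vertex is removed, any other first tree is split
   in two by detaching its leftmost branch. *)
Require Import Defs.
From mathcomp Require Import all_boot all_order all_algebra.
From mathcomp Require Import classical_sets cardinality.
From mathcomp Require Import functions zify.
Import GRing.Theory.
Local Open Scope nat_scope.
Local Open Scope card_scope.

#[local] Set Implicit Arguments.
#[local] Unset Strict Implicit.
#[local] Arguments edges : simpl never.
#[local] Arguments vertices : simpl never.

(** * Subtrees, edge counts and vertex addresses *)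

Definition children (t : plane_tree) : seq plane_tree := let: Node ts := t in ts.

Lemma childrenK t : Node (children t) = t.
Proof. by case: t. Qed.

Fixpoint subtree (t : plane_tree) (v : address) : plane_tree :=
  if v is i :: w then subtree (nth (Node [::]) (children t) i) w else t.

Lemma edges_cons t ts :
  edges (Node (t :: ts)) = (edges t).+1 + edges (Node ts).
Proof. by []. Qed.

Lemma edges_cat ts us :
  edges (Node (ts ++ us)) = edges (Node ts) + edges (Node us).
Proof. by rewrite /edges /= map_cat sumn_cat. Qed.

Lemma edges_nil : edges (Node [::]) = 0.
Proof. by []. Qed.

Definition edgesE := (edges_nil, edges_cons, edges_cat).

Lemma size_le_edges ts : size ts <= edges (Node ts).
Proof. by elim: ts => // t ts IH; rewrite edges_cons /=; lia. Qed.

Lemma vertices_nil t : [::] \in vertices t.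
Proof. by case: t => ts; rewrite /vertices inE. Qed.

Lemma vertices_cons ts i w :
  (i :: w \in vertices (Node ts))
  = (i < size ts) && (w \in vertices (nth (Node [::]) ts i)).
Proof.
rewrite /vertices -/vertices inE /=; apply/allpairsPdep/andP => [[j [x [+ + [-> ->]]]]|[lti wi]].
  by rewrite mem_iota /= => ltj; rewrite (nth_map (Node [::])).
by exists i, w; split=> //; rewrite ?mem_iota // (nth_map (Node [::])).
Qed.

(** Addresses grow from the front in [vertices], but kinship is read off their last entry; this
    links the two. *)
Lemma vertices_rcons t u i :
  (rcons u i \in vertices t)
  = (u \in vertices t) && (i < size (children (subtree t u))).
Proof.
elim: u t => [|j u IH] [ts] /=.
  by rewrite vertices_cons !vertices_nil andbT.
by rewrite !vertices_cons IH andbA.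
Qed.

(** * Degrees and elder siblings from addresses and subtrees *)

Lemma parent_rcons u i : parent (rcons u i) = u.
Proof. by rewrite /parent size_rcons -cats1 take_size_cat. Qed.

Lemma child_rcons u v i : child u (rcons v i) = (v == u).
Proof. by rewrite /child parent_rcons -size_eq0 size_rcons. Qed.

Lemma outdegreeE t v :
  v \in vertices t -> outdegree t v = size (children (subtree t v)).
Proof.
move=> vt; set d := size _.
rewrite /outdegree -size_filter.
have /perm_size -> : perm_eq [seq x <- vertices t | child v x]
                       [seq rcons v i | i <- iota 0 d].
  apply: uniq_perm.
  - exact/filter_uniq/uniq_vertices.
  - by rewrite map_inj_uniq ?iota_uniq //; apply: rcons_injr.
  - move=> x; rewrite mem_filter; apply/andP/mapP.
      case/lastP: x => [[]//|x i]; rewrite child_rcons => -[/eqP->].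
      by rewrite vertices_rcons => /andP[_ lti]; exists i; rewrite ?mem_iota.
    case=> i; rewrite mem_iota => /andP[_ lti] ->.
    by rewrite child_rcons vertices_rcons vt eqxx.
by rewrite size_map size_iota.
Qed.

Lemma elder_siblingsE t v : v \in vertices t -> elder_siblings t v = last 0 v.
Proof.
case/lastP: v => [|u j] vt.
  rewrite /elder_siblings (eq_count (a2 := pred0)) ?count_pred0 // => x.
  by rewrite /elder_sibling /siblings andbF.
rewrite /elder_siblings -size_filter.
have /perm_size -> : perm_eq [seq x <- vertices t | elder_sibling (rcons u j) x]
                       [seq rcons u i | i <- iota 0 j].
  apply: uniq_perm.
  - exact/filter_uniq/uniq_vertices.
  - by rewrite map_inj_uniq ?iota_uniq //; apply: rcons_injr.
  - move: vt; rewrite vertices_rcons => /andP[ut ltj].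
    have nz w i : (rcons w i != [::]) by rewrite -size_eq0 size_rcons.
    move=> x; rewrite mem_filter; apply/andP/mapP.
      case/lastP: x => [[]//|x i].
      rewrite /elder_sibling /siblings !nz !parent_rcons !last_rcons /=.
      by case=> /andP[/eqP-> lti] _; exists i; rewrite ?mem_iota.
    case=> i; rewrite mem_iota => /andP[_ lti] ->.
    rewrite /elder_sibling /siblings !nz !parent_rcons !last_rcons eqxx /=.
    by rewrite vertices_rcons ut (ltn_trans lti ltj).
by rewrite size_map size_iota last_rcons.
Qed.

Lemma leafE t v :
  v \in vertices t -> leaf t v = (size (children (subtree t v)) == 0).
Proof. by move=> vt; rewrite -outdegreeE // /leaf has_count lt0n negbK. Qed.

Lemma first_childE t v :
  v \in vertices t -> first_child t v = (v != [::]) && (last 0 v == 0).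
Proof.
by move=> vt; rewrite -(elder_siblingsE vt) /first_child has_count lt0n negbK.
Qed.

Lemma vertices_parent t v : v \in vertices t -> parent v \in vertices t.
Proof.
case/lastP: v => [//|u j]; rewrite vertices_rcons parent_rcons.
by case/andP.
Qed.

Lemma degreeE t v : v \in vertices t ->
  degree t v = (v != [::]) + size (children (subtree t v)).
Proof.
move=> vt; rewrite -outdegreeE // /degree /outdegree.
have -> : count (adjacent v) (vertices t)
    = count (predU (child v) (fun x => child x v)) (vertices t).
  exact: eq_count.
(* A common element would be both longer and shorter than [v]. *)
have disj : count (predI (child v) (fun x => child x v)) (vertices t) = 0.
  rewrite (eq_count (a2 := pred0)) ?count_pred0 // => x /=.
  case/lastP: x => [//|x i]; rewrite child_rcons.
  case: eqP => [-> /=|//].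
  rewrite /child; case/lastP: v {vt} => [//|v j].
  rewrite parent_rcons; apply/negP => /andP[_ /eqP/(congr1 size)].
  by rewrite !size_rcons; lia.
rewrite -[LHS]addn0 -disj count_predUI addnC; congr (_ + _).
case: (eqVneq v [::]) => [->|v0] /=.
  by rewrite (eq_count (a2 := pred0)) ?count_pred0 // => x; rewrite /child eqxx.
rewrite (eq_count (a2 := pred1 (parent v))) => [|x].
  by rewrite count_uniq_mem ?uniq_vertices // vertices_parent.
by rewrite /child v0 /= eq_sym.
Qed.

(** * Counting ordered forests *)

(** [w] includes one edge per tree to an added root, so [g] proper edges give [w = g + s]. *)
Definition forests (s w : nat) : set (seq plane_tree) :=
  [set fs | size fs = s /\ edges (Node fs) = w]%classic.

Lemma card_setU_disjoint {T : Type} (A B : set T) (a b : nat) :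
  (A `&` B = set0)%classic -> A #= `I_a -> B #= `I_b ->
  (A `|` B)%classic #= `I_(a + b).
Proof.
move=> AB0 /card_set_bijP[f [fA finj fsurj]] /card_set_bijP[g [gB ginj gsurj]].
have nAB x : A x -> ~ B x.
  by move=> Ax Bx; have : (A `&` B)%classic x by []; rewrite AB0.
apply/card_set_bijP; exists (fun x => if x \in A then f x else a + g x); split.
- move=> x /= [Ax|Bx]; first by rewrite mem_set //; have /= := fA _ Ax; lia.
  rewrite ifN; first by have /= := gB _ Bx; lia.
  by apply/negP; rewrite inE => /nAB.
- move=> x y; rewrite !inE => xAB yAB.
  case: ifPn; case: ifPn; rewrite ?notin_setE ?inE => Ay Ax.
  + by apply: finj; rewrite inE.
  + by have /= := fA _ Ax; lia.
  + by have /= := fA _ Ay; lia.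
  + case: xAB => // Bx; case: yAB => // By.
    by move=> /addnI; apply: ginj; rewrite inE.
- move=> i /= ltiab; case: (ltnP i a) => [lti|lei].
    have [x Ax <-] := fsurj i lti.
    by exists x; [left | rewrite mem_set].
  have /gsurj[x Bx gx] : `I_b (i - a) by rewrite /=; lia.
  exists x; first by right.
  rewrite ifN; first by rewrite gx; lia.
  by apply/negP; rewrite inE => /nAB.
Qed.

(** Undoes the detaching of a leftmost branch: the edge from [t] to the added root becomes an edge
    to the root of [u]. *)
Definition graft (fs : seq plane_tree) : seq plane_tree :=
  if fs is t :: u :: fs' then Node (t :: children u) :: fs' else fs.

Lemma forestsSS s w : forests s.+1 w.+1
  = (cons (Node [::]) @` forests s w `|` graft @` forests s.+2 w.+1)%classic.
Proof.
apply/seteqP; split=> [fs|fs].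
  case: fs => [[]//|[[|t ts]] fs] [/= [sz]]; rewrite !edgesE => ew.
    by left; exists fs => //; split=> //; lia.
  right; exists (t :: Node ts :: fs) => //.
  by split; rewrite ?edgesE /= ?sz //; lia.
case=> [[gs [sz ew] <-]|[[|t [|[ts] gs]] [//= [sz]] + <-]].
  by split; rewrite ?edgesE /= ?sz //; lia.
by rewrite !edgesE => ew; split; rewrite ?edgesE /= ?sz //; lia.
Qed.

(* The forests with [g] edges in [s] trees are counted by the ballot numbers
   s / (2g + s) * 'C(2g + s, g); the division is cleared to allow s = g = 0. *)
Lemma card_forests g s : exists2 N : nat, forests s (g + s) #= `I_N &
  (2 * g + s) * N = s * 'C(2 * g + s, g).
Proof.
elim: g s => [|g IHg] s.
  exists 1; last by rewrite bin0 !muln1.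
  rewrite (_ : forests _ _ = [set nseq s (Node [::])])%classic.
    exact: card_set1.
  apply/seteqP; split=> [fs [<-]|_ ->].
    rewrite add0n; elim: fs => //= -[[|t ts]] fs IH; rewrite !edgesE.
      by move=> h; rewrite -IH //=; lia.
    by have := size_le_edges fs; lia.
  split; rewrite ?size_nseq // add0n.
  by elim: s => //= s IH; rewrite edges_cons IH.
elim: s => [|s [a IHa eqa]].
  exists 0; last by rewrite muln0 mul0n.
  rewrite (_ : forests _ _ = set0)%classic ?II0 //.
  by apply/seteqP; split=> // fs [/size0nil->]; rewrite edges_nil; lia.
(* Detaching a branch costs one proper edge and creates one tree. *)
have [b IHb eqb] := IHg s.+2.
exists (a + b).
  rewrite addnS forestsSS; apply: card_setU_disjoint.
  - apply/seteqP; split=> // fs [[gs _ <-]].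
    by case=> -[|t [|u hs]] [].
  - by rewrite (card_eql (inj_card_eq _)) // => x y _ _ [].
  - rewrite (_ : (g.+1 + s).+1 = g + s.+2); last by lia.
    rewrite (card_eql (inj_card_eq _)) // => x y; rewrite !inE.
    case: x => [|t [|[ts] gs]] [//= [sz _]].
    by case: y => [|t' [|[ts'] gs']] [//= _ _] [-> -> ->].
move: eqa eqb; rewrite (_ : 2 * g.+1 + s = 2 * g + s.+2); last by lia.
rewrite (_ : 2 * g.+1 + s.+1 = (2 * g + s.+2).+1); last by lia.
rewrite binS; have := mul_bin_left (2 * g + s.+2) g.
rewrite (_ : 2 * g + s.+2 - g = g + s.+2); last by lia.
set c0 := 'C(_, g); set c1 := 'C(_, g.+1) => hc ha hb.
(* This factor lets [ha] and [hb] eliminate [a] and [b]; [hc] relates the two binomials. *)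
apply/eqP; rewrite -(eqn_pmul2l (m := 2 * g + s.+2)); last by lia.
apply/eqP; nia.
Qed.

(** * Encoding marked trees by forests *)

(* Vertices at level [l] satisfying [Q], a predicate of the number of elder
   siblings (0 at the root) and of the outdegree. *)
Definition located (Q : nat -> nat -> bool) (l : nat) :
    set (plane_tree * address) :=
  [set p | [/\ p.2 \in vertices p.1, size p.2 = l &
    Q (last 0 p.2) (size (children (subtree p.1 p.2)))]]%classic.

(* Adding a root to a forest turns it into a tree, with [c] more edges than the
   tree that the forest encodes. *)
Definition forest_code (f : seq plane_tree -> plane_tree * address)
    (s c : nat) (A : set (plane_tree * address)) : Prop :=
  set_bij [set fs | size fs = s]%classic A f /\
  forall fs, size fs = s -> edges (Node fs) = edges (f fs).1 + c.

Lemma card_forest_code f s c A n : forest_code f s c A ->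
  ([set p | A p /\ edges p.1 = n]%classic #= forests s (n + c)).
Proof.
move=> [[fA finj fsurj] fe].
have -> : ([set p | A p /\ edges p.1 = n] = f @` forests s (n + c))%classic.
  apply/seteqP; split=> [p [/fsurj[fs sz <-] en]|_ [fs [sz ew] <-]].
    by exists fs => //; split=> //; rewrite fe // en.
  by split; [apply: fA|move: ew; rewrite fe //; lia].
apply: inj_card_eq => x y; rewrite !inE => -[sx _] [sy _].
by apply: finj; rewrite inE.
Qed.

(* Lets [f] encode a marked subtree hanging from a new root, whose other children
   are those of the first two trees. *)
Definition deepen (f : seq plane_tree -> plane_tree * address)
    (fs : seq plane_tree) : plane_tree * address :=
  if fs is a :: b :: fs' then
    (Node (children a ++ (f fs').1 :: children b),
     size (children a) :: (f fs').2)
  else f fs.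

Lemma nth_cat_size (ts us : seq plane_tree) t :
  nth (Node [::]) (ts ++ t :: us) (size ts) = t.
Proof. by rewrite nth_cat ltnn subnn. Qed.

(** The marked position is the length of the left part, so a marked tree determines where its list
    of children is cut. *)
Lemma cat_cons_inj (T : Type) (a a' b b' : seq T) x x' :
  size a = size a' -> a ++ x :: b = a' ++ x' :: b' -> [/\ a = a', x = x' & b = b'].
Proof.
elim: a a' => [|y a IH] [|y' a'] //= => [_ [-> ->] //|[/IH{}IH] [-> /IH[-> -> ->]]].
by [].
Qed.

(** The two new trees bring two edges to the added root while the path gains one, so [c] grows by
    one. At [l = 0] the marked root, with default elder-sibling count 0, moves to an arbitrary
    position, so [Q] must ignore that count. *)
Lemma forest_code_deepen f s c Q l :
  (l = 0 -> forall x y d, Q x d = Q y d) ->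
  forest_code f s c (located Q l) ->
  forest_code (deepen f) s.+2 c.+1 (located Q l.+1).
Proof.
move=> Q0 [[fA finj fsurj] fe].
have Qcons i w d : size w = l -> Q (last 0 (i :: w)) d = Q (last 0 w) d.
  by case: w => [/esym/Q0 h|//]; apply: h.
split; last first.
  move=> [|[a] [|[b] fs]] //= [/fe]; rewrite !edgesE; lia.
split.
- move=> [|[a] [|[b] fs]] //= [/fA]; rewrite /located /=.
  case: (f fs) => t w [/= tw sz Qw]; split.
  + by rewrite vertices_cons nth_cat_size tw size_cat /=; lia.
  + by rewrite sz.
  + by rewrite nth_cat_size Qcons.
- move=> x y; rewrite !inE; case: x => [|[a] [|[b] x]] //= [sx].
  case: y => [|[a'] [|[b'] y]] //= [sy].
  case=> + sz e2 => /(cat_cons_inj sz)[-> e1 ->].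
  congr [:: _, _ & _]; apply: finj; rewrite ?inE //.
  by rewrite [LHS]surjective_pairing e1 e2 -surjective_pairing.
- move=> [[ts] [|i w]] [] //=; rewrite vertices_cons => /andP[lti tw] [sz] Qw.
  have [|fs sfs ef] := fsurj (nth (Node [::]) ts i, w).
    by split=> //=; rewrite -(Qcons i).
  exists (Node (take i ts) :: Node (drop i.+1 ts) :: fs); first by rewrite /= sfs.
  by rewrite /= ef /= size_take lti -drop_nth // cat_take_drop.
Qed.

Lemma forest_code_iter f s c Q l j :
  (l = 0 -> forall x y d, Q x d = Q y d) ->
  forest_code f s c (located Q l) ->
  forest_code (iter j deepen f) (j.*2 + s) (j + c) (located Q (j + l)).
Proof.
move=> Q0 fc; elim: j => [|j IH] //=.
by apply: forest_code_deepen => // /eqP; rewrite addn_eq0 => /andP[_ /eqP/Q0].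
Qed.

(** * Starting codes for the four kinds of marked vertices *)

(** Starts (iv), and settles (ii) at level 0. *)
Lemma forest_code_root k :
  forest_code (fun fs => (Node fs, [::])) k 0 (located (fun _ d => d == k) 0).
Proof.
split=> [|fs _ /=]; last by rewrite addn0.
split=> [fs /= <-|x y _ _ []//|[t [|i w]] [] //= _ _ /eqP sz].
  by split; rewrite ?vertices_nil /=.
by exists (children t); rewrite ?childrenK.
Qed.

(** No tree is kept left of the path: a first-child has no elder siblings. *)
Definition mark_first_child (fs : seq plane_tree) : plane_tree * address :=
  if fs is b :: ts then (Node (Node ts :: children b), [:: 0])
  else (Node [::], [::]).

Lemma forest_code_first_child k :
  forest_code mark_first_child k.+1 0
    (located (fun x d => (x == 0) && (d == k)) 1).
Proof.
split=> [|[|[b] ts] //= _]; last by rewrite !edgesE; lia.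
split=> [[|[b] ts] //= [sz]|x y|].
- by split; rewrite ?vertices_cons /= ?vertices_nil ?sz.
- by rewrite !inE; case: x => [|[b] x]; case: y => [|[b'] y] //= _ _ [-> ->].
- move=> [[ts] [|i [|j w]]] [] //=; rewrite vertices_cons.
  case: ts => [|[ts] us] //= _ _ /andP[/eqP-> /eqP sz].
  by exists (Node us :: ts); rewrite /= ?sz.
Qed.

(** The tree left of the path has an edge, so it splits into its leftmost branch [t] and the rest
    [a]; [t] takes position 0, whence the successor. *)
Definition mark_non_first_child (fs : seq plane_tree) : plane_tree * address :=
  if fs is t :: a :: b :: ts then
    (Node (t :: children a ++ Node ts :: children b),
     [:: (size (children a)).+1])
  else (Node [::], [::]).

Lemma forest_code_non_first_child k :
  forest_code mark_non_first_child k.+3 1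
    (located (fun x d => (0 < x) && (d == k)) 1).
Proof.
split=> [|[|t [|[a] [|[b] ts]]] //= _]; last by rewrite !edgesE; lia.
split=> [[|t [|[a] [|[b] ts]]] //= [sz]|x y|].
- split; rewrite ?vertices_cons /= ?nth_cat_size ?vertices_nil ?sz ?eqxx //.
  by rewrite size_cat /=; lia.
- rewrite !inE; case: x => [|t [|[a] [|[b] x]]] //= _.
  case: y => [|t' [|[a'] [|[b'] y]]] //= _.
  by case=> -> + sz => /(cat_cons_inj sz)[-> [->] ->].
- move=> [[[|t ts]] [|[|i] [|j w]]] [] //=; rewrite vertices_cons //=.
  rewrite ltnS => /andP[lti _] _ /eqP sz.
  exists [:: t, Node (take i ts), Node (drop i.+1 ts)
    & children (nth (Node [::]) ts i)]; first by rewrite /= sz.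
  by rewrite /= childrenK -drop_nth // cat_take_drop size_take lti.
Qed.

(** The elder siblings' subtrees are the trees of [a] themselves, so the forest size fixes their
    number. *)
Definition mark_leaf (fs : seq plane_tree) : plane_tree * address :=
  if fs is b :: a then (Node (a ++ Node [::] :: children b), [:: size a])
  else (Node [::], [::]).

Lemma forest_code_leaf k :
  forest_code mark_leaf k.+1 0
    (located (fun x d => (x == k) && (d == 0)) 1).
Proof.
split=> [|[|[b] a] //= _]; last by rewrite !edgesE; lia.
split=> [[|[b] a] //= [sz]|x y|].
- split; rewrite ?vertices_cons /= ?nth_cat_size ?vertices_nil ?sz ?eqxx //.
  by rewrite size_cat /=; lia.
- rewrite !inE; case: x => [|[b] x]; case: y => [|[b'] y] //= _ _.
  by case=> + sz => /(cat_cons_inj sz)[-> _ ->].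
- move=> [[ts] [|i [|j w]]] [] //=; rewrite vertices_cons.
  move=> /andP[lti _] _ /andP[/eqP <- /nilP/= sz].
  exists (Node (drop i.+1 ts) :: take i ts); first by rewrite /= size_take lti.
  by rewrite /= -sz childrenK -drop_nth // cat_take_drop size_take lti.
Qed.

(** * Cardinalities and the closed formula *)

Lemma card_marked_trees n P Q l f s c :
  (forall t v, v \in vertices t -> P t v
     = (size v == l) && Q (last 0 v) (size (children (subtree t v)))) ->
  forest_code f s c (located Q l) ->
  marked_trees n P #= forests s (n + c).
Proof.
move=> PE fc; rewrite -(card_eqr (card_forest_code n fc)).
rewrite (_ : marked_trees n P = [set p | located Q l p /\ edges p.1 = n]%classic) //.
apply/seteqP; split=> -[t v] [/=].
  by move=> en tv; rewrite PE // => /andP[/eqP sz Qv].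
by case=> /= tv sz Qv en; split=> //=; rewrite PE // sz eqxx.
Qed.

(** Here [k] and [l] are one less than in the theorem. *)
Lemma card_forests_ballot n k l : 0 < n ->
  exists2 N : nat, forests (l.*2 + k.+1) (n + l) #= `I_N &
    (N%:R = (k.+1%:R + 2 * l.+1%:R - 2) / (2 * n%:R - k.+1%:R)
            * 'C(2 * n - k.+1, n + l.+1 - 1)%:R :> rat)%R.
Proof.
move=> n_gt0; rewrite (_ : n + l.+1 - 1 = n + l); last by lia.
case: (leqP (l + k.+1) n) => hn; last first.
  (* Both sides vanish: the edges to the added root alone exceed [n + l], and the binomial is out of
     range. *)
  exists 0; last by rewrite bin_small ?mulr0 //; lia.
  rewrite (_ : forests _ _ = set0)%classic ?II0 //.
  apply/seteqP; split=> // fs [sz ew].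
  by have := size_le_edges fs; rewrite sz ew; lia.
(* The number of proper edges is [n + l] minus the number of trees. *)
have [N cN eN] := card_forests (n - (l + k.+1)) (l.*2 + k.+1).
exists N; first by move: cN; rewrite (_ : n - _ + _ = n + l) //; lia.
move: eN; rewrite -bin_sub; last by lia.
rewrite (_ : 2 * _ + _ = 2 * n - k.+1); last by lia.
rewrite (_ : _ - (n - _) = n + l); last by lia.
move=> /(congr1 (fun m : nat => m%:R : rat)%R).
rewrite !natrM natrB; last by lia.
rewrite natrM => eN.
have nz : (2 * n%:R - k.+1%:R != 0 :> rat)%R.
  rewrite -natrM -natrB; last by lia.
  by rewrite Num.Theory.pnatr_eq0; lia.
apply: (mulfI nz); rewrite eN mulrA [(_ * (_ / _))%R]mulrCA mulfV // mulr1.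
congr (_ * _)%R.
rewrite -natrM -natrD -[X in (_ - X)%R]/(2%:R)%R -natrB; last by lia.
by congr (_%:R)%R; lia.
Qed.

#[local] Unset Implicit Arguments.

(** * The four correspondences *)

Theorem theorem1p4 (n k l : nat) (n_gt0 : 0 < n) (k_gt0 : 0 < k)
    (l_gt0 : 0 < l) :
  let S1 := marked_trees n (fun T v =>
    [&& first_child T v, degree T v == k & level v == l]) in
  let S2 := marked_trees n (fun T v =>
    [&& ~~ first_child T v, degree T v == k & level v == l - 1]) in
  let S3 := marked_trees n (fun T v =>
    [&& leaf T v, elder_siblings T v == k - 1 & level v == l]) in
  let S4 := marked_trees n (fun T v =>
    [&& ~~ leaf T v, outdegree T v == k & level v == l - 1]) in
  [/\ S1 #= S2, S2 #= S3 & S3 #= S4] /\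
  exists N : nat,
    [/\ S1 #= `I_N, S2 #= `I_N, S3 #= `I_N & S4 #= `I_N] /\
    (N%:R = (k%:R + 2 * l%:R - 2) / (2 * n%:R - k%:R)
            * 'C(2 * n - k, n + l - 1)%:R :> rat)%R.
Proof.
move=> S1 S2 S3 S4.
case: k k_gt0 => // k _ in S1 S2 S3 S4 *; case: l l_gt0 => // l _ in S1 S2 S3 S4 *.
(* Codes starting at level 1 meet the level-0 condition vacuously. *)
have neq10 (P : Prop) : 1 = 0 -> P by [].
set F := forests (l.*2 + k.+1) (n + l).
have c1 : S1 #= F.
  have := forest_code_iter l (neq10 _) (forest_code_first_child k).
  rewrite addn0 addn1; apply: card_marked_trees => t v tv.
  rewrite first_childE // degreeE // /level.
  by case: v {tv} => [|i v] //=; rewrite add1n eqSS; do !case: (_ == _).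
have c2 : S2 #= F.
  (* At level 0 the vertex is the root, whose degree is its outdegree; deeper, one edge goes to the
     parent. *)
  case: l @S1 @S2 @S3 @S4 @F {c1} => [|l] S1 S2 S3 S4 F.
    have := forest_code_root k.+1; rewrite /F addn0 -[n in forests _ n]addn0.
    apply: card_marked_trees => t v tv.
    rewrite first_childE // degreeE // /level.
    by case: v {tv} => [|i v] /=; rewrite ?andbT ?andbF.
  have := forest_code_iter l (neq10 _) (forest_code_non_first_child k).
  rewrite addn1.
  (* One descent fewer than in (i) is offset by two more trees in the starting code. *)
  rewrite (_ : l.*2 + k.+3 = l.+1.*2 + k.+1); last by lia.
  apply: card_marked_trees => t v tv.
  rewrite first_childE // degreeE // /level subn1 /=.
  case: v {tv} => [|i v] /=; first by rewrite andbF.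
  by rewrite add1n eqSS lt0n; do !case: (_ == _).
have c3 : S3 #= F.
  have := forest_code_iter l (neq10 _) (forest_code_leaf k).
  rewrite addn0 addn1; apply: card_marked_trees => t v tv.
  rewrite leafE // elder_siblingsE // /level subn1 /=.
  by do !case: (_ == _).
have c4 : S4 #= F.
  have := @forest_code_iter _ _ _ (fun _ d => d == k.+1) 0 l
    (fun _ _ _ _ => erefl) (forest_code_root k.+1).
  rewrite !addn0; apply: card_marked_trees => t v tv.
  rewrite leafE // outdegreeE // /level subn1 /=.
  by case: eqP => [->|_] /=; rewrite ?andbF // andbC.
have [N cN eN] := card_forests_ballot k l n_gt0.
split; last first.
  by exists N; rewrite (card_eql c1) (card_eql c2) (card_eql c3) (card_eql c4).
have trans A B : A #= F -> B #= F -> A #= B.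
  by move=> AF BF; apply: card_eq_trans AF (card_esym BF).
by split; apply: trans.
Qed.
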